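(* Let $X$ and $Y$ be countable regular $T_1$ spaces without isolated points whose topologies are analytic. If $X$ and $Y$ are $SS^+$, then $X\times Y$ (with the product topology) is $SS^+$.
   Context: For a countable set $X$, $2^X$ is the power set of $X$, identified via characteristic functions with the product of copies of the discrete space $\{0,1\}$, with the product topology. The topology $\tau$ of $X$ is analytic if $\tau$ is an analytic subset of $2^X$ (a continuous image of a Polish space). The game $G_{fin}$ on a space $X$: in round $n\in\mathbb N$, player I picks a dense subset $D_n$ of $X$ and then player II picks a finite set $a_n\subseteq D_n$. Player II wins the run if $\bigcup_n a_n$ is dense in $X$; otherwise player I wins. $X$ is $SS^+$ if player II has a winning strategy for $G_{fin}$. *)

(* Defs.v *)
From HB Require Import structures.
From mathcomp Require Import all_boot all_order all_algebra.
From mathcomp Require Import all_classical all_reals all_analysis.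

Set Implicit Arguments.
Unset Strict Implicit.
Unset Printing Implicit Defensive.

Import Order.TTheory GRing.Theory Num.Theory.

Local Open Scope classical_set_scope.
Local Open Scope ring_scope.

Definition is_metric (R : realType) (T : Type) (d : T -> T -> R) : Prop :=
  [/\ forall x y, 0 <= d x y,
      forall x y, d x y = 0 <-> x = y,
      forall x y, d x y = d y x &
      forall x y z, d x z <= d x y + d y z].

Definition metric_induces_topology (R : realType) (T : topologicalType)
    (d : T -> T -> R) : Prop :=
  forall U : set T, open U <->
    (forall x, U x -> exists2 e : R, 0 < e & [set y | d x y < e] `<=` U).

Definition metric_complete (R : realType) (T : topologicalType)
    (d : T -> T -> R) : Prop :=
  forall u : nat -> T,
    (forall e : R, 0 < e -> exists N : nat, forall m n : nat,
       (N <= m)%N -> (N <= n)%N -> d (u m) (u n) < e) ->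
    exists l : T, u n @[n --> \oo] --> l.

Definition completely_metrizable (R : realType) (T : topologicalType) : Prop :=
  exists d : T -> T -> R,
    [/\ is_metric d, metric_induces_topology d & metric_complete d].

Definition separable_space (T : topologicalType) : Prop :=
  exists2 D : set T, countable D & dense D.

Definition polish_space (R : realType) (T : topologicalType) : Prop :=
  completely_metrizable R T /\ separable_space T.

(* A topologicalType may be empty, so the empty set is analytic. *)
Definition analytic_set (R : realType) (S : topologicalType) (A : set S) :
    Prop :=
  exists (P : topologicalType) (f : P -> S),
    [/\ polish_space R P, continuous f & range f = A].

(* [{ptws X -> bool}] is 2^X: the X-fold product of the discrete space [bool].
   A characteristic function [chi] stands for the set [[set x | chi x]]. *)
Definition topology_family (X : topologicalType) : set {ptws X -> bool} :=
  [set chi : {ptws X -> bool} | open [set x : X | chi x]].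
Arguments topology_family X : clear implicits.

Definition analytic_topology (R : realType) (X : topologicalType) : Prop :=
  analytic_set R (topology_family X).

(* A strategy for player II in G_fin maps the nonempty history
   [:: D_0; ...; D_n] of the moves of player I to the answer a_n. *)
Definition strategyII (X : topologicalType) : Type := seq (set X) -> set X.

Definition answer (X : topologicalType) (s : strategyII X)
    (D : nat -> set X) (n : nat) : set X := s (mkseq D n.+1).

Definition winning_Gfin (X : topologicalType) (s : strategyII X) : Prop :=
  forall D : nat -> set X, (forall n, dense (D n)) ->
    (forall n, finite_set (answer s D n) /\ answer s D n `<=` D n) /\
    dense (\bigcup_n answer s D n).

Definition SSplus (X : topologicalType) : Prop :=
  exists s : strategyII X, winning_Gfin s.

(* Main.v *)
(** At a position [h] of the game, let [F_h] be the family of finite sets with which the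
winning strategy answers the dense sets, and let [K_h] be the family of sets
that meet every member of [F_h]. In [2^X] the family [K_h] is compact, and its
elements have nonempty interior, since the complement of such an element
contains no answer and hence is not dense. As [X] is countable, countably many
positions suffice to see every finite answer, and a nonempty open set lying in
none of the corresponding [K_h] would be missed by a run in which the strategy
is followed. So [SSplus X] amounts to covering the nonempty open sets by
countably many such [K_h], and this property is productive: the sets [A `*` B]
with [A] in [K_h] and [B] in [K_k] again form a compact family of sets with
nonempty interior, so that every dense subset of [X * Y] has a finite subset
meeting all of them. *)

Require Import Defs.
From HB Require Import structures.
From mathcomp Require Import finmap.
From mathcomp Require Import all_boot all_order all_algebra.
From mathcomp Require Import all_classical all_reals all_analysis.

Local Open Scope classical_set_scope.

Definition hitting (T : Type) (F : set (set T)) : set (set T) :=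
  [set A | forall a, F a -> A `&` a !=set0].

Definition catching (T : topologicalType) (F : set (set T)) : Prop :=
  (forall a, F a -> finite_set a) /\
  forall D, dense D -> exists2 a, F a & a `<=` D.

Lemma hitting_interior (T : topologicalType) (F : set (set T)) (A : set T) :
  catching T F -> hitting T F A -> interior A !=set0.
Proof.
move=> [_ catF] hitA; apply: contrapT => A0.
have dA : dense (~` A).
  move=> O [x Ox] oO; apply: contrapT => OA; apply: A0; exists x.
  rewrite /interior /= nbhsE; exists O => // y Oy.
  by apply: contrapT => nAy; apply: OA; exists y.
have [a Fa aA] := catF _ dA.
by have [x [Ax /aA]] := hitA _ Fa.
Qed.

(* Compactness of [hitting T F] in [2^T], as closure under ultralimits. *)
Lemma ultra_hitting (T : choiceType) (I : Type) (F : set (set T))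
    (U : set_system I) (S : I -> set T) :
    (forall a, F a -> finite_set a) -> UltraFilter U ->
    U [set i | hitting T F (S i)] -> hitting T F [set x | U [set i | S i x]].
Proof.
move=> finF ultU hitU a Fa; apply: contrapT => a0.
have /finite_fsetP[s sE] := finF _ Fa.
have missU : U (\bigcap_(x in [set` s]) [set i | ~ S i x]).
  apply: filter_bigI => x xs.
  have [Ux|//] := in_ultra_setVsetC [set i | S i x] ultU.
  by case: a0; exists x; split=> //; rewrite sE.
have [i [/(_ _ Fa)[x [Sx ax]] miss]] := filter_ex (filterI hitU missU).
by apply: (miss x) => //; rewrite -sE.
Qed.

(** Round [pickle i] is devoted to [i]: the answer there is a member of [F i] inside the current
    dense set, so it meets every set in [hitting T (F i)]. *)
Lemma SSplus_of_catching (T : topologicalType) (I : countType)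
    (F : I -> set (set T)) :
    (forall i, catching T (F i)) ->
    (forall U, open U -> U !=set0 -> exists i, hitting T (F i) U) ->
  SSplus T.
Proof.
move=> catF cover.
pose s (h : seq (set T)) : set T :=
  (* The history includes the current move, hence the predecessor. *)
  if unpickle (size h).-1 is Some i
  then xget set0 [set a | F i a /\ a `<=` last set0 h] else set0.
have sE D n : answer s D n =
    if unpickle n is Some i then xget set0 [set a | F i a /\ a `<=` D n]
    else set0.
  by rewrite /answer /s size_mkseq mkseqS last_rcons.
exists s => D dD; split=> [n|].
  rewrite sE; case: unpickle => [i|]; last by split=> //; exact: finite_set0.
  have [a Fa aD] := (catF i).2 _ (dD n).
  case: xgetP => [b _ [Fb bD]|/(_ a) []//].
  by split=> //; exact: (catF i).1.
move=> U U0 oU; have [i hitU] := cover U oU U0.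
have [a Fa aD] := (catF i).2 _ (dD (pickle i)).
have := sE D (pickle i); rewrite pickleK.
case: xgetP => [b _ [Fb _]|/(_ a) []//] sD.
have [x [Ux bx]] := hitU _ Fb.
by exists x; split=> //; exists (pickle i) => //; rewrite sD.
Qed.

Lemma catching_of_SSplus (T : topologicalType) :
    countable [set: T] -> SSplus T ->
  exists F : seq (seq nat) -> set (set T),
    (forall l, catching T (F l)) /\
    forall U, open U -> U !=set0 -> exists l, hitting T (F l) U.
Proof.
move=> /countable_injP[f injf] [s win].
(* A list [l] codes the answers of the strategy, latest first, a finite set
   being coded through [f]; [pos l] is a history producing these answers. *)
pose E h (c : seq nat) := xget setT
  [set D | dense D /\ s (rcons h D) = [set x | f x \in c]].
have denseT : dense [set: T] by move=> O [x Ox] _; exists x.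
(* The default [setT] keeps this true when no dense set draws the answer coded by [c]. *)
have dE h c : dense (E h c) by rewrite /E; case: xgetP => // D _ [].
pose pos := fix pos (l : seq (seq nat)) :=
  if l is c :: l' then rcons (pos l') (E (pos l') c) else [::].
have dpos l n : dense (nth setT (pos l) n).
  elim: l n => [|c l IH] n /=; first by rewrite nth_nil.
  by rewrite nth_rcons; case: ltnP => // _; case: eqP.
have winpos l D : dense D ->
    finite_set (s (rcons (pos l) D)) /\ s (rcons (pos l) D) `<=` D.
  (* Continuing the finite history by [setT] gives a full run, to which [win] applies. *)
  move=> dD; pose D' := nth setT (rcons (pos l) D).
  have dD' n : dense (D' n).
    by rewrite /D' nth_rcons; case: ltnP => // _; case: eqP.
  have D'l : D' (size (pos l)) = D by rewrite /D' nth_rcons ltnn eqxx.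
  have [/(_ (size (pos l)))] := win _ dD'.
  by rewrite /answer D'l -(size_rcons (pos l) D) mkseq_nth.
have EP l D : dense D -> exists c,
    s (rcons (pos l) (E (pos l) c)) = s (rcons (pos l) D).
  move=> dD; have [finD _] := winpos l D dD.
  have /finite_seqP[c cE] := finite_image f finD.
  have sc : s (rcons (pos l) D) = [set x | f x \in c].
    apply/seteqP; split=> x /= sx.
      by have : [set` c] (f x) by rewrite -cE; exists x.
    have : [set` c] (f x) by [].
    by rewrite -cE => -[y sy /injf <-]; rewrite ?in_setT.
  exists c; rewrite sc {1}/E.
  by case: xgetP => [_ _ []//|/(_ D) []].
exists (fun l => [set s (rcons (pos l) D) | D in @dense T]); split=> [l|U oU U0].
  split=> [_ [D dD <-]|D dD]; first by have [] := winpos l D dD.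
  by exists (s (rcons (pos l) D)); [exists D | have [] := winpos l D dD].
apply: contrapT => nhit.
have miss l : exists c, ~ (U `&` s (rcons (pos l) (E (pos l) c)) !=set0).
  apply: contrapT => nc; apply: nhit; exists l => _ [D dD <-].
  have [c cE] := EP l D dD.
  by apply: contrapT => UD; apply: nc; exists c; rewrite cE.
have [c cP] := choice miss.
(* Always adding an answer that misses [U] yields a run whose answers all miss [U], against
   [win]. *)
pose l n := iter n (fun l => c l :: l) [::].
pose D n := E (pos (l n)) (c (l n)).
have posl n : pos (l n) = mkseq D n.
  by elim: n => [//|n IH]; rewrite mkseqS -IH.
have [_ /(_ U U0 oU) [x [Ux [n _]]]] := win D (fun n => dE _ _).
by rewrite /answer mkseqS -posl => sx; apply: (cP (l n)); exists x.
Qed.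

(** Taking all such finite sets puts the products [A]*[B] into the hitting family by definition. *)
Definition boxes (X Y : Type) (F : set (set X)) (G : set (set Y)) :
    set (set (X * Y)) :=
  [set a | finite_set a /\
    forall A B, hitting X F A -> hitting Y G B -> (A `*` B) `&` a !=set0].

(** By compactness: if each finite subset of [D] is missed by some product, an ultralimit of such
    products still has nonempty interior, hence contains a point of [D]; yet almost all of the
    products miss that point. *)
Lemma catching_boxes (X Y : topologicalType) (F : set (set X))
    (G : set (set Y)) :
  catching X F -> catching Y G -> catching (X * Y)%type (boxes X Y F G).
Proof.
move=> catF catG; split=> [a []//|D dD]; apply: contrapT => noa.
pose P (a : set (X * Y)) := [set p : set X * set Y |
  [/\ hitting X F p.1, hitting Y G p.2 & ~ ((p.1 `*` p.2) `&` a !=set0)]].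
pose small := [set a : set (X * Y) | finite_set a /\ a `<=` D].
have filtP : ProperFilter (filter_from small P).
  apply: filter_from_proper.
    apply: filter_from_filter; first by exists set0; split.
    move=> a b [fa aD] [fb bD]; exists (a `|` b).
      by split; [rewrite finite_setU | move=> x [/aD|/bD]].
    move=> [A B] [/= hA hB nAB].
    by split; split=> //= -[x [ABx xab]]; apply: nAB; exists x; split=> //;
      [left|right].
  move=> a [fa aD]; apply: contrapT => Pa; apply: noa; exists a => //.
  split=> // A B hA hB; apply: contrapT => ABa.
  by apply: Pa; exists (A, B).
have [U [ultU PU]] := ultraFilterLemma filtP.
have UP a : small a -> U (P a) by move=> sa; apply: PU; exists a.
(* Almost every pair consists of hitting sets, as [ultra_hitting] requires. *)
have U0 : U (P set0) by apply: UP; split.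
have hA : hitting X F [set x | U [set p | p.1 x]].
  apply: ultra_hitting => //; first exact: catF.1.
  by apply: filterS U0 => p [].
have hB : hitting Y G [set y | U [set p | p.2 y]].
  apply: ultra_hitting => //; first exact: catG.1.
  by apply: filterS U0 => p [].
have [x Ax] := hitting_interior _ _ _ catF hA.
have [y By] := hitting_interior _ _ _ catG hB.
set A := [set x | _] in hA Ax; set B := [set y | _] in hB By.
have AB0 : interior (A `*` B) !=set0 by exists (x, y); exists (A, B).
have [[x' y'] [/interior_subset[/= Ux' Uy'] Dxy]] :=
  dD _ AB0 (open_interior _).
have sxy : small [set (x', y')].
  by split=> [|_ ->//]; exact: finite_set1.
have [p [[px py] [_ _]]] := filter_ex (filterI (filterI Ux' Uy') (UP _ sxy)).
by apply; exists (x', y').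
Qed.

Lemma SSplus_prod (X Y : topologicalType) :
    countable [set: X] -> countable [set: Y] -> SSplus X -> SSplus Y ->
  SSplus (X * Y)%type.
Proof.
move=> cX cY /(catching_of_SSplus X cX)[F [catF covF]].
move=> /(catching_of_SSplus Y cY)[G [catG covG]].
apply: (SSplus_of_catching (X * Y)%type (seq (seq nat) * seq (seq nat))%type
  (fun i => boxes X Y (F i.1) (G i.2))) => [i|W oW [[x y] Wxy]].
  exact: catching_boxes.
have : nbhs (x, y) W by apply: open_nbhs_nbhs.
move=> [[P Q] /= [nP nQ] PQW].
have [l hP] : exists l, hitting X (F l) (interior P).
  by apply: covF; [exact: open_interior | exists x].
have [m hQ] : exists m, hitting Y (G m) (interior Q).
  by apply: covG; [exact: open_interior | exists y].
exists (l, m) => a [_ /(_ _ _ hP hQ)[z [[Pz Qz] az]]].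
by exists z; split=> //; apply: PQW; split; exact: interior_subset.
Qed.

Theorem theorem4p8 (R : realType) (X Y : topologicalType)
  (countX : countable [set: X]) (countY : countable [set: Y])
  (regX : regular_space X) (regY : regular_space Y)
  (T1X : accessible_space X) (T1Y : accessible_space Y)
  (isoX : isolated [set: X] = set0) (isoY : isolated [set: Y] = set0)
  (anX : analytic_topology R X) (anY : analytic_topology R Y)
  (ssX : SSplus X) (ssY : SSplus Y) :
  SSplus (X * Y)%type.
Proof. exact: SSplus_prod. Qed.
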